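(* Let $G=(V,E)$ be a finite directed graph with vertex weights $w:V\to\mathbb{R}^+$ such that $w(u)<w(v)$ for every $(u,v)\in E$, with edge costs $d((u,v))=w(v)-w(u)$; let $r\in V$ and $\gamma\geq0$. At the end of the tight-pair algorithm described below, run on $G$, $r$, $\gamma$, the set $R$ contains exactly the tight pairs of $G$ for threshold $\gamma$ whose first element is $r$.
   Context: A path in $G$ is a sequence $(u_1,\ldots,u_k)$, $k\geq1$, with $(u_i,u_{i+1})\in E$; its cost is the sum of its edge costs (0 if $k=1$). A path $p=(u_1,\ldots,u_k)$ is tight (for $\gamma$) if its cost is $\leq\gamma$ and every path obtained by adding one new edge $(u_0,u_1)\in E$ at the start or $(u_k,u_{k+1})\in E$ at the end has cost $>\gamma$. A tight pair is a pair $(u,v)$ such that some tight path starts at $u$ and ends at $v$. The algorithm: let $d_0=\min\{w(r)-w(u):(u,r)\in E\}$, or $d_0=\infty$ if $r$ has no in-edge. Set $R=\emptyset$ and $S=\emptyset$ (visited vertices), and initialize a stack containing $r$. While the stack is nonempty: pop the top vertex $v$; add $v$ to $S$; set $\mathit{mayextend}=\mathrm{False}$; for each edge $(v,u)\in E$: if $w(u)-w(r)\leq\gamma$, then push $u$ onto the stack if $u\notin S$, and (in either case) set $\mathit{mayextend}=\mathrm{True}$; after processing all such edges, if $\mathit{mayextend}$ is False and $d_0+w(v)-w(r)>\gamma$, add the pair $(r,v)$ to $R$. When the stack is empty, return $R$. *)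

(* Defs.v *)
From HB Require Import structures.
From mathcomp Require Import all_boot all_order all_algebra.
From mathcomp Require Import reals constructive_ereal.

Set Implicit Arguments.
Unset Strict Implicit.
Unset Printing Implicit Defensive.

Import Order.TTheory GRing.Theory Num.Theory.
Local Open Scope ring_scope.

Section TightPairs.

Variables (R : realType) (V : finType) (E : rel V) (w : V -> R).

Definition edge_cost (u v : V) : R := w v - w u.

(* The nonempty vertex sequence (u_1, ..., u_k) is represented by its head     *)
(* u_1 and its tail [:: u_2; ...; u_k]; it is a path when path E u_1 tail.     *)
Definition path_cost (u : V) (p : seq V) : R :=
  \sum_(c <- pairmap edge_cost u p) c.

Definition tight (gamma : R) (u : V) (p : seq V) : Prop :=
  [/\ path E u p,
      path_cost u p <= gamma,
      forall u0, E u0 u -> gamma < path_cost u0 (u :: p)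
    & forall v, E (last u p) v -> gamma < path_cost u (rcons p v)].

Definition tight_pair (gamma : R) (u v : V) : Prop :=
  exists2 p, tight gamma u p & last u p = v.

Section Algorithm.

Variables (r : V) (gamma : R).

Definition d0 : \bar R :=
  \big[Order.min/+oo%E]_(u | E u r) (w r - w u)%:E.

(* The head of [stack] is the top of the stack. *)
Record state := State {
  stack : seq V;
  visited : {set V};
  result : {set V * V}
}.

Definition init_state : state := State [:: r] set0 set0.

(* Body of the inner loop, for the edge to u; the pair is (stack, mayextend).  *)
Definition scan_edge (S : {set V}) (a : seq V * bool) (u : V) : seq V * bool :=
  if w u - w r <= gamma
  then (if u \in S then a.1 else u :: a.1, true)
  else a.

(* One iteration of the outer loop, after popping v from v :: s; es lists the  *)
(* out-neighbours of v in the order in which the inner loop scans them.        *)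
Definition iteration (v : V) (s : seq V) (S : {set V}) (T : {set V * V})
    (es : seq V) : state :=
  let S' := v |: S in
  let a := foldl (scan_edge S') (s, false) es in
  let mayextend := a.2 in
  State a.1 S'
    (if ~~ mayextend && (gamma%:E < d0 + (w v - w r)%:E)%E
     then (r, v) |: T else T).

(* The scanning order is unspecified, hence chosen freely at each iteration.   *)
Variant step : state -> state -> Prop :=
| Step v s S T es of perm_eq es (enum (E v)) :
    step (State (v :: s) S T) (iteration v s S T es).

(* run st T : some execution of the loop from st ends and returns T. *)
Inductive run : state -> {set V * V} -> Prop :=
| RunStop S T : run (State [::] S T) T
| RunStep st st' T of step st st' & run st' T : run st T.

(* Every execution from st is finite; as a step exists whenever the stack is   *)
(* nonempty, every maximal execution then ends with the empty stack.           *)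
Definition terminates (st : state) : Prop :=
  Acc (fun st2 st1 => step st1 st2) st.

End Algorithm.

End TightPairs.

(* Main.v *)
(* Edge costs telescope, so a path from u to v costs w v - w u and tightness
   depends only on the endpoints and on the existence of a path.  Every vertex
   on a path from r to v weighs at most w v, so the vertices reached at cost at
   most gamma are those reached through such vertices only, which is what the
   search explores.  A vertex may be expanded several times, but popping it
   replaces it by vertices of larger weight, at most #|V| of them; hence the
   sum over the stack of (#|V| + 1) ^ #|{heavier vertices}| decreases. *)
Require Import Defs.
From mathcomp Require Import all_boot all_order all_algebra.
From mathcomp Require Import reals constructive_ereal.

Set Implicit Arguments.
Unset Strict Implicit.
Unset Printing Implicit Defensive.

Import Order.TTheory GRing.Theory Num.Theory.
Local Open Scope ring_scope.

Section TightPairSearch.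

Variables (R : realType) (V : finType) (E : rel V) (w : V -> R).
Variables (r : V) (gamma : R).

Lemma path_costE u p : path_cost w u p = w (last u p) - w u.
Proof.
rewrite /path_cost; elim: p u => [|x p IHp] u /=; first by rewrite big_nil subrr.
by rewrite big_cons IHp /edge_cost addrC subrKA.
Qed.

Definition in_range : pred V := fun u => w u - w r <= gamma.

Definition reachable v := exists2 p, path E r p & last r p = v.

Definition maximal v :=
  ~~ [exists u, E v u && in_range u] && (gamma%:E < d0 E w r + (w v - w r)%:E)%E.

(** The costs of [(u, r)] and of a path from [r] to [v] add up to [w v - w u]. If [r] has no
    in-edge, the minimum is its default [+oo] and both sides hold trivially. *)
Lemma lt_d0D v :
  reflect (forall u, E u r -> gamma < w v - w u)
          (gamma%:E < d0 E w r + (w v - w r)%:E)%E.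
Proof.
rewrite -lteBlDr // -EFinB /d0; apply: (iffP (bigmin_gtP _ _ _ _)).
  move=> [_ lt_d] u Eur; have := lt_d u Eur.
  by rewrite lte_fin ltrBlDr addrC subrKA.
move=> lt_d; split=> [|u Eur]; first exact: ltry.
by rewrite lte_fin ltrBlDr addrC subrKA lt_d.
Qed.

Lemma tight_pairE v :
  tight_pair E w gamma r v <-> [/\ reachable v, in_range v & maximal v].
Proof.
split=> [[p [Ep cost_p pre_p post_p] <-{v}] | [[p Ep <-{v}] rng_p]].
  split; [by exists p | by rewrite /in_range -path_costE |].
  apply/andP; split.
    apply/existsP=> -[u /andP[Eu]]; rewrite /in_range leNgt => /negP[].
    by have := post_p u Eu; rewrite path_costE last_rcons.
  by apply/lt_d0D => u Eur; have := pre_p u Eur; rewrite path_costE.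
case/andP=> /existsPn no_ext /lt_d0D lt_d; exists p => //; split=> //.
- by rewrite path_costE.
- by move=> u Eur; rewrite path_costE lt_d.
move=> u Eu; rewrite path_costE last_rcons ltNge.
by have := no_ext u; rewrite Eu.
Qed.

(** Pushing one by one reverses the scanning order, hence [rev]. Visited neighbours are not pushed
    but still set the flag. The accumulators [s] and [b] are arbitrary so that the induction on [es]
    goes through. *)
Lemma foldl_scan_edge (S : {set V}) es s b :
  foldl (scan_edge w r gamma S) (s, b) es =
  (rev [seq u <- es | in_range u & u \notin S] ++ s, b || has in_range es).
Proof.
elim: es s b => [|u es IHes] s b /=; first by rewrite orbF.
rewrite {2}/scan_edge -/(in_range u); case: (in_range u) => /=; last exact: IHes.
by case: (u \in S); rewrite IHes ?orbT //= rev_cons cat_rcons.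
Qed.

Lemma iterationE v s (S : {set V}) T es : perm_eq es (enum (E v)) ->
  iteration E w r gamma v s S T es =
  State (rev [seq u <- es | in_range u & u \notin v |: S] ++ s) (v |: S)
        (if maximal v then (r, v) |: T else T).
Proof.
move=> es_v; rewrite /iteration foldl_scan_edge /maximal /=.
suff ->: has in_range es = [exists u, E v u && in_range u] by [].
rewrite (perm_has _ es_v); apply/hasP/existsP.
  by case=> u; rewrite mem_enum => Evu rng_u; exists u; apply/andP.
by case=> u /andP[Evu rng_u]; exists u; rewrite ?mem_enum.
Qed.

Hypothesis w_incr : forall u v, E u v -> w u < w v.

Definition potential v := (#|V|.+1 ^ #|[set x | (w v < w x)%R]|)%N.

(** Along an edge the set of heavier vertices loses at least one element, namely [v], so the
    exponent drops. *)
Lemma potential_edge u v : E u v -> (#|V|.+1 * potential v <= potential u)%N.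
Proof.
move=> Euv; rewrite -expnS; apply: leq_pexp2l => //.
apply/proper_card/properP; split.
  by apply/subsetP=> x; rewrite !inE; apply: lt_trans (w_incr Euv).
by exists v; rewrite inE ?ltxx ?w_incr.
Qed.

Lemma sum_potential_out v (P : pred V) es : perm_eq es (enum (E v)) ->
  (\sum_(u <- es | P u) potential u < potential v)%N.
Proof.
move=> es_v; have pot_gt0: (0 < potential v)%N by rewrite expn_gt0.
(* After scaling by [#|V|.+1], each of the at most [#|V|] terms is bounded by [potential v]. *)
rewrite -(ltn_pmul2l (ltn0Sn #|V|)) big_distrr /=.
apply: leq_ltn_trans (_ : #|V| * potential v < _)%N; last first.
  by rewrite ltn_pmul2r.
apply: leq_trans (_ : \sum_(u <- es) potential v <= _)%N; last first.
  rewrite big_const_seq count_predT iter_addn_0 mulnC leq_mul2r.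
  by rewrite (perm_size es_v) -cardE max_card orbT.
rewrite big_mkcond big_seq [X in (X <= _)%N]big_seq; apply: leq_sum => u.
rewrite (perm_mem es_v) mem_enum => Evu; case: (P u) => //.
exact: potential_edge.
Qed.

Lemma search_terminates st : terminates E w r gamma st.
Proof.
have [n] := ubnP (\sum_(u <- stack st) potential u)%N.
elim: n st => [|n IHn] st; first by rewrite ltn0.
rewrite ltnS => le_n; apply: Acc_intro => st' st_st'.
apply: IHn; apply: leq_trans le_n; case: st_st' => v s S T es es_v.
rewrite iterationE //= big_cat big_cons ltn_add2r.
by rewrite (perm_big _ (permEl (perm_rev _))) big_filter sum_potential_out.
Qed.

(** The first two clauses give soundness. The next two say that the stack holds the whole frontier:
    once it is empty, the visited set contains [r] and is closed under edges to vertices in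
    range. *)
Definition search_invariant (st : state V) :=
  [/\ forall v, v \in stack st -> reachable v /\ in_range v,
      forall v, v \in visited st -> reachable v /\ in_range v,
      (r \in visited st) || (r \in stack st),
      forall u v, u \in visited st -> E u v -> in_range v ->
        (v \in visited st) || (v \in stack st)
    & result st = [set (r, v) | v in visited st & maximal v]].

Lemma search_invariant_init : 0 <= gamma -> search_invariant (init_state r).
Proof.
move=> gamma_ge0; split=> /= [v | v | | u v | ]; rewrite ?inE ?eqxx ?orbT //.
  by move/eqP->; split; [exists [::] | rewrite /in_range subrr].
by apply/esym/eqP; rewrite -subset0; apply/subsetP=> z /imsetP[v]; rewrite !inE.
Qed.

Lemma search_invariant_step st st' :
  step E w r gamma st st' -> search_invariant st -> search_invariant st'.
Proof.
case=> v s S T es es_v [/= stackP visitedP r_in closed ->].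
have [[p Ep last_p] rng_v] := stackP v (mem_head _ _).
rewrite iterationE //; split=> /=.
- move=> u; rewrite mem_cat mem_rev mem_filter (perm_mem es_v) mem_enum.
  case/orP=> [/andP[/andP[rng_u _] Evu] | u_s]; last first.
    by apply: stackP; rewrite inE u_s orbT.
  by split=> //; exists (rcons p u); rewrite ?last_rcons // rcons_path Ep last_p.
- by move=> u /setU1P[-> | /visitedP //]; split=> //; exists p.
- by move: r_in; rewrite !inE mem_cat; case/or3P=> ->; rewrite ?orbT.
- move=> u x u_in Eux rng_x; rewrite mem_cat mem_rev mem_filter.
  rewrite (perm_mem es_v) mem_enum rng_x /=.
  (* An unvisited [x] has just been pushed if [u] is [v]; otherwise it was already on the stack and,
     differing from [v], it stays there. *)
  case: (boolP (x \in v |: S)) => //=; rewrite !inE => /norP[x'v x'S].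
  case/setU1P: u_in Eux => [-> Evx | uS Eux]; first by apply/orP; left.
  have := closed u x uS Eux rng_x.
  by rewrite (negPf x'S) inE (negPf x'v) /= => ->; rewrite orbT.
(* Here [v] may have been visited before; its pair is then added again, which leaves the set
   unchanged. *)
apply/setP=> z; apply/idP/imsetP.
  case: ifP => max_v.
    case/setU1P=> [-> | /imsetP[x]].
      by exists v => //; rewrite !inE eqxx.
    by rewrite inE => /andP[xS mx] ->; exists x => //; rewrite !inE xS mx orbT.
  case/imsetP=> x; rewrite inE => /andP[xS mx] ->.
  by exists x => //; rewrite !inE xS mx orbT.
case=> x; rewrite !inE => /andP[/predU1P[-> | xS] mx] ->.
  by rewrite mx setU11.
have zS: (r, x) \in [set (r, v0) | v0 in S & maximal v0].
  by apply: imset_f; rewrite inE xS.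
by case: ifP => // _; rewrite inE zS orbT.
Qed.

(** Induction on the path from its last edge: the predecessor of a vertex in range is lighter, hence
    in range too, and closure carries membership forward. *)
Lemma visited_complete st v : search_invariant st -> stack st = [::] ->
  reachable v -> in_range v -> v \in visited st.
Proof.
case=> _ _ r_in closed _ st0 [p Ep <-{v}]; rewrite st0 in_nil orbF in r_in.
elim/last_ind: p Ep => [|p x IHp] //; rewrite rcons_path last_rcons.
case/andP=> Ep Ex rng_x; rewrite -[_ \in _]orbF -(in_nil x) -st0.
apply: (closed _ _ _ Ex rng_x); apply: IHp Ep _.
by apply: le_trans rng_x; rewrite lerD2r ltW ?w_incr.
Qed.

(** Stated from any state satisfying the invariant, to allow induction on the run. *)
Lemma run_tight_pairs st T : run E w r gamma st T -> search_invariant st ->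
  forall u v, (u, v) \in T <-> tight_pair E w gamma u v /\ u = r.
Proof.
elim=> [S {}T inv u v | {}st st' {}T st_st' _ IHrun inv]; last first.
  by apply: IHrun; apply: search_invariant_step inv.
have complete := visited_complete inv erefl.
case: inv => /= _ visitedP _ _ ->; split.
  case/imsetP=> x; rewrite inE => /andP[xS max_x] [-> ->].
  by split=> //; apply/tight_pairE; have [] := visitedP x xS.
case=> tight_uv eq_ur; subst u.
have [reach_v rng_v max_v] := (tight_pairE v).1 tight_uv.
by apply: imset_f; rewrite inE complete.
Qed.

End TightPairSearch.

Theorem theorem4 (R : realType) (V : finType) (E : rel V) (w : V -> R)
    (r : V) (gamma : R)
    (w_gt0 : forall v, 0 < w v)
    (w_incr : forall u v, E u v -> w u < w v)
    (gamma_ge0 : 0 <= gamma) :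
  terminates E w r gamma (init_state r) /\
  forall T : {set V * V}, run E w r gamma (init_state r) T ->
    forall u v : V, (u, v) \in T <-> tight_pair E w gamma u v /\ u = r.
Proof.
split=> [|T run_T]; first exact: search_terminates.
by apply: (run_tight_pairs w_incr run_T); apply: search_invariant_init.
Qed.
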